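(* Assume $g\equiv 0$, and that $f\in C^2(\mathbb{R})$ satisfies $\liminf_{|s|\to\infty} f(s)/s>-1$, $|f''(s)|\le\ell_1(1+|s|)$ and $f'(s)\ge-\ell_2$ for all $s\in\mathbb{R}$ and some $\ell_1,\ell_2\ge 0$. For each $\varepsilon\in(0,1]$, the global attractor $\mathcal{A}_\varepsilon$ of the semiflow $S_\varepsilon$ of Problem (A) is bounded in $\mathcal{D}_\varepsilon$. In addition, $$\dim_{\mathrm{F}}(\mathcal{A}_\varepsilon,\mathcal{H}_\varepsilon)\le\dim_{\mathrm{F}}(\mathcal{M}_\varepsilon,\mathcal{H}_\varepsilon)\le C_\varepsilon$$ for some constant $C_\varepsilon>0$ depending on $\varepsilon$, where $\mathcal{M}_\varepsilon$ is the exponential attractor of $(S_\varepsilon,\mathcal{H}_\varepsilon)$ described in the context. As a consequence, the global attractors $\mathcal{A}_\varepsilon$ are finite dimensional.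
   Context: $\Omega\subset\mathbb{R}^3$ is a bounded domain with smooth boundary $\Gamma$ and outward unit normal $\mathbf{n}$; $\|\cdot\|$, $\|\cdot\|_k$ are the norms of $L^2(\Omega)$, $H^k(\Omega)$. Problem (A) with $g\equiv 0$, for $\varepsilon\in(0,1]$: $u_{tt}+u_t-\Delta u+u+f(u)=0$ in $(0,\infty)\times\Omega$; $\delta_{tt}+\varepsilon[\delta_t+\delta]=-u_t$ and $\delta_t=\partial_{\mathbf{n}}u$ on $(0,\infty)\times\Gamma$; $u(0)=u_0$, $u_t(0)=u_1$, $\varepsilon\delta(0)=\varepsilon\delta_0$, $\delta_t(0)=\delta_1$. $\mathcal{H}_\varepsilon=H^1(\Omega)\times L^2(\Omega)\times L^2(\Gamma)\times L^2(\Gamma)$ with $\|(u,v,\delta,\gamma)\|_{\mathcal{H}_\varepsilon}^2=\|u\|_1^2+\|v\|^2+\varepsilon\|\delta\|_{L^2(\Gamma)}^2+\|\gamma\|_{L^2(\Gamma)}^2$. $\mathcal{D}_\varepsilon=\{(u,v,\delta,\gamma)\in H^2(\Omega)\times H^1(\Omega)\times H^{1/2}(\Gamma)\times H^{1/2}(\Gamma):\partial_{\mathbf{n}}u=\gamma\text{ on }\Gamma\}$ with $\|(u,v,\delta,\gamma)\|_{\mathcal{D}_\varepsilon}^2=\|u\|_2^2+\|v\|_1^2+\varepsilon\|\delta\|_{H^{1/2}(\Gamma)}^2+\|\gamma\|_{H^{1/2}(\Gamma)}^2$. The operator $\mathrm{A}_\varepsilon(u,v,\delta,\gamma)=(v,\Delta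 u-u-v,\gamma,-v-\varepsilon\delta-\varepsilon\gamma)$ with domain $\{(u,v,\delta,\gamma)\in\mathcal{H}_\varepsilon:\Delta u\in L^2(\Omega),\ v\in H^1(\Omega),\ \partial_{\mathbf{n}}u=\gamma\text{ on }\Gamma\}$ generates a strongly continuous contraction semigroup on $\mathcal{H}_\varepsilon$; $\mathcal{G}_\varepsilon(u,v,\delta,\gamma)=(0,-f(u),0,0)$. For $\zeta_0=(u_0,u_1,\delta_0,\delta_1)\in\mathcal{H}_\varepsilon$ the unique global weak (mild) solution $\zeta=(u,u_t,\delta,\delta_t)\in C([0,\infty);\mathcal{H}_\varepsilon)$ satisfies $\zeta(t)=e^{\mathrm{A}_\varepsilon t}\zeta_0+\int_0^te^{\mathrm{A}_\varepsilon(t-s)}\mathcal{G}_\varepsilon(\zeta(s))\,ds$ for all $t\ge 0$, and $S_\varepsilon(t)\zeta_0:=\zeta(t)$. The global attractor $\mathcal{A}_\varepsilon$ is the unique compact set in $\mathcal{H}_\varepsilon$, invariant under $S_\varepsilon$, that attracts all nonempty bounded sets in the semidistance $\mathrm{dist}_{\mathcal{H}_\varepsilon}(A,B)=\sup_{a\in A}\inf_{b\in B}\|a-b\|_{\mathcal{H}_\varepsilon}$. $\dim_{\mathrm{F}}(\mathcal{M},X)=\limsup_{r\to0}\frac{\ln\mu_X(\mathcal{M},r)}{-\ln r}$, where $\mu_X(\mathcal{M},r)$ is the minimum number of $r$-balls of $X$ needed to cover $\mathcal{M}$. $\mathcal{M}_\varepsilon$ is an exponential attractor (shown in the paper to exist):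 a set compact in $\mathcal{H}_\varepsilon$ and bounded in $\mathcal{D}_\varepsilon$, with $S_\varepsilon(t)\mathcal{M}_\varepsilon\subseteq\mathcal{M}_\varepsilon$ for all $t\ge 0$, with finite fractal dimension in $\mathcal{H}_\varepsilon$, and with $\mathrm{dist}_{\mathcal{H}_\varepsilon}(S_\varepsilon(t)B,\mathcal{M}_\varepsilon)\le Q_\varepsilon(\|B\|_{\mathcal{H}_\varepsilon})e^{-\nu_{1\varepsilon}t}$ for all $t\ge0$ and every nonempty bounded $B\subset\mathcal{H}_\varepsilon$, for some increasing $Q_\varepsilon\ge0$ and $\nu_{1\varepsilon}>0$, where $\|B\|_{\mathcal{H}_\varepsilon}=\sup_{\zeta\in B}\|\zeta\|_{\mathcal{H}_\varepsilon}$. *)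

(* Defs.v *)
From HB Require Import structures.
From mathcomp Require Import all_boot all_order all_algebra.
From mathcomp Require Import all_classical all_reals all_analysis.
From mathcomp Require Import measurable_realfun ring_quotient ring lra.
Set Implicit Arguments.
Unset Strict Implicit.
Unset Printing Implicit Defensive.
Import Order.TTheory GRing.Theory Num.Theory.
Import numFieldNormedType.Exports.
Local Open Scope classical_set_scope.
Local Open Scope ring_scope.

Section Space.
Context (R : realType).

Definition space : Type :=
  (measurableTypeR R * measurableTypeR R * measurableTypeR R)%type.

Definition coor (i : 'I_3) (x : space) : R := [:: x.1.1; x.1.2; x.2]`_i.

Definition basis_vec (i : 'I_3) : space :=
  ((i == 0%N :> nat)%:R, (i == 1%N :> nat)%:R, (i == 2%N :> nat)%:R).

(* the canonical norm on R * R * R is the max norm *)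
Definition euclid (x : space) : R := Num.sqrt (\sum_(i < 3) coor i x ^+ 2).

Definition pderiv (i : 'I_3) (f : space -> R) : space -> R :=
  fun x => 'D_(basis_vec i) f x.

Fixpoint Ck_on (U : set space) (k : nat) (f : space -> R) : Prop :=
  {in U, continuous f} /\
  if k is k'.+1 then
    forall i, (forall x, U x -> derivable f x (basis_vec i)) /\
              Ck_on U k' (pderiv i f)
  else True.

(* meaningful for open U *)
Definition smooth_on (U : set space) (f : space -> R) := forall k, Ck_on U k f.

Definition volume : {measure set space -> \bar R} :=
  (@lebesgue_measure R \x @lebesgue_measure R \x @lebesgue_measure R)%E.

Lemma open_measurable_space (A : set space) : open A -> measurable A.
Proof.
move=> oA.
pose J : choiceType := ((rat * rat) * (rat * rat) * (rat * rat))%type.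
pose I1 (q : rat * rat) : set R := `]ratr q.1, ratr q.2[%classic.
pose box (q : J) : set space := (I1 q.1.1 `*` I1 q.1.2) `*` I1 q.2.
have small (x : R) (U : set R) : nbhs x U -> exists2 q, I1 q x & I1 q `<=` U.
  move=> /nbhs_ballP[e /= e0 eU].
  have xe : x - e < x by rewrite ltrBlDr ltrDl.
  have ex : x < x + e by rewrite ltrDl.
  have [a /[!in_itv]/= /andP[a1 a2]] := rat_in_itvoo xe.
  have [b /[!in_itv]/= /andP[b1 b2]] := rat_in_itvoo ex.
  exists (a, b); first by rewrite /I1 /= in_itv /= a2 b1.
  move=> y; rewrite /I1 /= in_itv /= => /andP[ay yb]; apply: eU.
  rewrite /ball /= ltr_distlC; apply/andP; split.
    by rewrite (lt_trans a1).
  by rewrite (lt_trans yb).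
have -> : A = \bigcup_(q in [set q : J | box q `<=` A]) box q.
  apply/seteqP; split=> [x Ax|x [q /= qA qx]]; last exact: qA.
  have [[B C] /= [nB nC] BCA] : nbhs x A by exact: open_nbhs_nbhs.
  have [[B1 B2] /= [nB1 nB2] BB] := nB.
  have [q1 q1x q1B] := small _ _ nB1.
  have [q2 q2x q2B] := small _ _ nB2.
  have [q3 q3x q3C] := small _ _ nC.
  exists ((q1, q2), q3) => //= y [[/= y1 y2] y3].
  by apply: BCA; split => /=; [apply: BB; split; [exact: q1B|exact: q2B]|exact: q3C].
rewrite bigcup_mkcond.
apply: countable_bigcupT_measurable; first exact: countableP.
move=> q; case: ifPn => _; last exact: measurable0.
by apply: measurableX; [apply: measurableX|]; exact: measurable_itv.
Qed.

Lemma continuous_measurable_space (f : space -> R) :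
  continuous f -> measurable_fun setT f.
Proof.
move=> /continuousP cf; apply: (measurability _ (RGenOpens.measurableE R)).
move=> _ [_ [a [b ->] <-]]; rewrite setTI.
by apply: open_measurable_space; apply: cf; exact: interval_open.
Qed.

Definition boundary (D : set space) : set space := closure D `\` D^°.

Record smooth_domain := SmoothDomain {
  domain_set :> set space;
  domain_open : open domain_set;
  domain_connected : connected domain_set;
  domain_neq0 : domain_set !=set0;
  domain_bounded : bounded_set domain_set;
  (* near each boundary point the domain is a regular sublevel set *)
  domain_smooth : forall p, boundary domain_set p ->
    exists (U : set space) (rho : space -> R),
      [/\ open U, U p, smooth_on U rho, exists i, pderiv i rho p != 0
        & domain_set `&` U = U `&` [set x | rho x < 0]] }.

Definition diam (A : set space) : \bar R :=
  ereal_sup (0%E |` [set (euclid (x - y))%:E | x in A & y in A]).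

Definition gauge2 (e : R) (A : set space) : \bar R :=
  if (diam A <= e%:E)%E then ((pi / 4)%:E * (diam A * diam A))%E else +oo%E.

(* two-dimensional Hausdorff measure, normalised to be the area of smooth
   surfaces; covering by Borel sets gives the same value as covering by
   arbitrary sets *)
Definition hausdorff2 (A : set space) : \bar R :=
  ereal_sup [set mu_ext (gauge2 e) A | e in [set e : R | 0 < e]].

Lemma diam_ge0 A : (0 <= diam A)%E.
Proof. by apply: ereal_sup_ubound; left. Qed.

Lemma gauge2_ge0 e A : (0 <= gauge2 e A)%E.
Proof.
rewrite /gauge2; case: ifP => // _.
by rewrite mule_ge0 ?mule_ge0 ?diam_ge0// lee_fin divr_ge0// pi_ge0.
Qed.

Lemma gauge20 e : 0 < e -> gauge2 e set0 = 0%E.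
Proof.
move=> e0; have d0 : diam set0 = 0%E.
  rewrite /diam (_ : [set _ | _ in _ & _ in _] = set0) ?setU0 ?ereal_sup1//.
  by rewrite -subset0 => ? [].
by rewrite /gauge2 d0 lee_fin (ltW e0) mul0e mule0.
Qed.

Lemma hausdorff2_0 : hausdorff2 set0 = 0%E.
Proof.
apply/eqP; rewrite eq_le; apply/andP; split.
  apply: ge_ereal_sup => _ [e /= e0 <-].
  by rewrite mu_ext0 ?gauge20//; exact: gauge2_ge0.
apply: ereal_sup_ubound; exists 1 => //=.
by rewrite mu_ext0 ?gauge20//; exact: gauge2_ge0.
Qed.

Lemma hausdorff2_ge0 A : (0 <= hausdorff2 A)%E.
Proof.
apply: (le_trans (mu_ext_ge0 (gauge2_ge0 1) A)).
by apply: ereal_sup_ubound; exists 1 => /=.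
Qed.

Lemma le_hausdorff2 : {homo hausdorff2 : A B / A `<=` B >-> (A <= B)%E}.
Proof.
move=> A B AB; apply: ge_ereal_sup => _ [e /= e0 <-].
apply: (le_trans (le_mu_ext _ AB)).
by apply: ereal_sup_ubound; exists e.
Qed.

Lemma hausdorff2_sigma_subadditive : sigma_subadditive hausdorff2.
Proof.
move=> F; apply: ge_ereal_sup => _ [e /= e0 <-].
have := mu_ext_sigma_subadditive (gauge2_ge0 e) F.
move=> /le_trans; apply.
apply: lee_nneseries => [i _ _|i _]; first exact: (mu_ext_ge0 (gauge2_ge0 e)).
by apply: ereal_sup_ubound; exists e.
Qed.

HB.instance Definition _ := isOuterMeasure.Build R space hausdorff2
  hausdorff2_0 hausdorff2_ge0 le_hausdorff2 hausdorff2_sigma_subadditive.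

Definition surface_outer (Omega : smooth_domain) (A : set space) : \bar R :=
  hausdorff2 (A `&` boundary Omega).

Lemma surface_outer0 Omega : surface_outer Omega set0 = 0%E.
Proof. by rewrite /surface_outer set0I hausdorff2_0. Qed.

Lemma surface_outer_ge0 Omega A : (0 <= surface_outer Omega A)%E.
Proof. exact: hausdorff2_ge0. Qed.

Lemma le_surface_outer Omega :
  {homo surface_outer Omega : A B / A `<=` B >-> (A <= B)%E}.
Proof. by move=> A B AB; apply: le_hausdorff2; exact: setSI. Qed.

Lemma surface_outer_sigma_subadditive Omega :
  sigma_subadditive (surface_outer Omega).
Proof.
by move=> F; rewrite /surface_outer setI_bigcupl;
   exact: hausdorff2_sigma_subadditive.
Qed.

HB.instance Definition _ Omega :=
  isOuterMeasure.Build R space (surface_outer Omega)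
    (surface_outer0 Omega) (surface_outer_ge0 Omega)
    (@le_surface_outer Omega) (@surface_outer_sigma_subadditive Omega).

(* area measure of the boundary, on the Caratheodory sigma-algebra; it does
   not charge the complement of the boundary *)
Definition surface_space (Omega : smooth_domain) :=
  caratheodory_type (surface_outer Omega).

Definition surface (Omega : smooth_domain) :
  set (surface_space Omega) -> \bar R := surface_outer Omega.
Arguments surface : clear implicits.

HB.instance Definition _ Omega := isMeasure.Build _ _ _ (surface Omega)
  (@caratheodory_measure0 _ _ (surface_outer Omega))
  (@caratheodory_measure_ge0 _ _ (surface_outer Omega))
  (@caratheodory_measure_sigma_additive _ _ (surface_outer Omega)).

Definition domain_measure (Omega : smooth_domain) :
    {measure set space -> \bar R} :=
  mrestr volume (open_measurable_space (@domain_open Omega)).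
End Space.
Arguments surface {R} Omega _.

Section L2.
Context d (T : measurableType d) (R : realType) (mu : {measure set T -> \bar R}).

Lemma le1_2 : (1 <= 2%:E :> \bar R)%E.
Proof. by rewrite lee_fin ler1n. Qed.

Definition L2fun := LfunType mu le1_2.

Definition L2null : {pred L2fun} := fun f => `[< f = 0 %[ae mu] >].

Lemma L2null_zmod_closed : zmod_closed L2null.
Proof.
split; first by apply/asboolP; exact: ae_eq_refl.
move=> f g /asboolP f0 /asboolP g0; apply/asboolP.
move: f0 g0; apply: filterS2 => x fx gx _ /=.
by rewrite [LHS](_ : _ = f x - g x)// fx// gx// subrr.
Qed.

HB.instance Definition _ :=
  GRing.isZmodClosed.Build L2fun L2null L2null_zmod_closed.

Definition L2 : Type := {ideal_quot L2null}.
HB.instance Definition _ := Choice.on L2.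
HB.instance Definition _ := GRing.Zmodule.on L2.
Definition L2class (f : L2fun) : L2 := \pi_({ideal_quot L2null})%qT f.
Definition L2repr (u : L2) : L2fun := repr u.

Lemma L2reprK u : L2class (L2repr u) = u.
Proof. exact: reprK. Qed.

Lemma L2classP (f g : L2fun) : L2class f = L2class g <-> f = g %[ae mu].
Proof.
have -> : (L2class f = L2class g) <-> (f - g) \in L2null.
  by split => [/eqP|] h; [rewrite Quotient.idealrBE|apply/eqP; rewrite -Quotient.idealrBE].
split => [/asboolP|] h; last apply/asboolP; move: h; apply: filterS => x h /h.
  by rewrite [LHS](_ : _ = f x - g x)// => /subr0_eq.
by rewrite [X in _ -> X = _](_ : _ = f x - g x)// => ->; rewrite subrr.
Qed.

Lemma L2classK (f : L2fun) : L2repr (L2class f) = f %[ae mu].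
Proof. by apply/L2classP; rewrite L2reprK. Qed.

Lemma L2classD f g : L2class (f + g) = L2class f + L2class g.
Proof. by rewrite /L2class raddfD. Qed.

Definition L2scale (a : R) (u : L2) : L2 := L2class (a *: L2repr u).

Lemma L2classZ a f : L2class (a *: f) = L2scale a (L2class f).
Proof.
apply/L2classP; apply: ae_eq_sym; have := L2classK f.
apply: filterS => x h /h fx.
by rewrite [LHS](_ : _ = a * L2repr (L2class f) x)// fx.
Qed.

Lemma L2scaleA a b u : L2scale a (L2scale b u) = L2scale (a * b) u.
Proof. by rewrite -[u]L2reprK -!L2classZ scalerA. Qed.

Lemma L2scale1 : left_id 1 L2scale.
Proof. by move=> u; rewrite /L2scale scale1r L2reprK. Qed.

Lemma L2scaleDr : right_distributive L2scale +%R.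
Proof.
by move=> a u v; rewrite -[u]L2reprK -[v]L2reprK -L2classD -!L2classZ scalerDr L2classD.
Qed.

Lemma L2scaleDl u : {morph L2scale^~ u : a b / a + b}.
Proof. by move=> a b; rewrite /L2scale scalerDl L2classD. Qed.

HB.instance Definition _ := GRing.Zmodule_isLmodule.Build R L2
  L2scaleA L2scale1 L2scaleDr L2scaleDl.

Definition L2norm (u : L2) : R := fine 'N[mu]_(2%:E)[EFin \o L2repr u].

Lemma L2norm_class f : L2norm (L2class f) = fine 'N[mu]_(2%:E)[EFin \o f].
Proof.
rewrite /L2norm; congr fine; rewrite unlock /Lnorm; congr poweR.
have mpow (g : L2fun) : measurable_fun setT (fun x => `|(EFin \o g) x| `^ 2)%E.
  apply/measurable_EFinP; apply: (measurableT_comp (measurable_powR _)).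
  exact: measurableT_comp.
apply: ge0_ae_eq_integral => //; try by move=> x _; exact: poweR_ge0.
by have := L2classK f; apply: filterS => x h /h /= ->.
Qed.

Lemma L2normD u v : L2norm (u + v) <= L2norm u + L2norm v.
Proof.
rewrite -[u]L2reprK -[v]L2reprK -L2classD !L2norm_class.
exact: ler_LnormD.
Qed.

Lemma L2normZ a u : L2norm (a *: u) = `|a| * L2norm u.
Proof.
have -> : a *: u = L2class (a *: L2repr u) by [].
by rewrite L2norm_class LnormZ fineM// -finite_norm_fine.
Qed.

Lemma L2norm_eq0 u : L2norm u = 0 -> u = 0.
Proof.
move=> u0; rewrite -[u]L2reprK -[RHS](raddf0 \pi_({ideal_quot L2null})%qT).
by apply/L2classP; exact: fine_Lnormr_eq0.
Qed.

HB.instance Definition _ := Lmodule_isNormed.Build R L2 L2normD L2normZ L2norm_eq0.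
End L2.

Section Pairing.
Context d (T : measurableType d) (R : realType) (mu : {measure set T -> \bar R}).

Definition pairing (u : L2 mu) (g : T -> R) : R :=
  \int[mu]_x (L2repr u x * g x).

Lemma integrable_pairing (u : L2fun mu) (g : T -> R) :
  g \in Lfun mu 2%:E -> mu.-integrable setT (EFin \o (u \* g)).
Proof. by move=> lg; apply/Lfun1_integrable; apply: Lfun2_mul_Lfun1 => //; exact: LfunP. Qed.

Lemma pairing_class (f : L2fun mu) (g : T -> R) : g \in Lfun mu 2%:E ->
  pairing (L2class f) g = \int[mu]_x (f x * g x).
Proof.
move=> lg; rewrite /pairing /Rintegral; congr fine.
apply: ae_eq_integral => //.
- exact: measurable_int (integrable_pairing _ lg).
- exact: measurable_int (integrable_pairing _ lg).
by have := L2classK f; apply: filterS => x h /h /= ->.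
Qed.

Lemma pairing_linear (g : T -> R) a (u v : L2 mu) : g \in Lfun mu 2%:E ->
  pairing (a *: u + v) g = a * pairing u g + pairing v g.
Proof.
move=> lg; have -> : a *: u + v = L2class (a *: L2repr u + L2repr v).
  by rewrite L2classD L2reprK.
rewrite pairing_class// /pairing -RintegralZl//; last exact: integrable_pairing.
rewrite -RintegralD//; last 2 first.
- have := integrable_pairing (a *: L2repr u) lg; apply: eq_integrable => // x _ /=.
  by rewrite -mulrA.
- exact: integrable_pairing.
by apply: eq_Rintegral => x _; rewrite mulrA -mulrDl.
Qed.
End Pairing.

Section Sobolev.
Context (R : realType) (Omega : smooth_domain R).
Local Notation space := (space R).
Local Notation mu := (domain_measure Omega).

Lemma domain_sub_box : exists M : R,
  Omega `<=` (`[- M, M]%classic `*` `[- M, M]%classic) `*` `[- M, M]%classic.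
Proof.
have [M [_ MO]] := domain_bounded Omega; exists (M + 1).
move=> x Ox; have : `|x : (R * R * R)%type| <= M + 1.
  exact: (MO _ (ltr_pwDr ltr01 (lexx M)) x Ox).
rewrite !prod_normE /= !ge_max => /andP[/andP[h1 h2] h3].
by split; [split|]; rewrite /= in_itv /= -ler_norml.
Qed.

Lemma domain_measure_fin : (mu setT < +oo)%E.
Proof.
have [M] := domain_sub_box.
pose I : set (measurableTypeR R) := `[- M, M]%classic => OI.
have mI : measurable I by exact: measurable_itv.
have mO := open_measurable_space (@domain_open _ Omega).
rewrite /domain_measure /= /mrestr setTI.
apply: (@le_lt_trans _ _ (volume R ((I `*` I) `*` I))).
  apply: le_measure => //; rewrite inE//.
  by apply: measurableX => //; exact: measurableX.
rewrite [ltLHS](@product_measure1E _ _ _ _ _ _ _)//; last exact: measurableX.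
rewrite [X in (X * _)%E](@product_measure1E _ _ _ _ _ _ _)//.
have If : (lebesgue_measure I < +oo)%E.
  have -> := @lebesgue_measure_itv R `[- M, M].
  by case: ifP => _; rewrite ltry.
have Ifin : (lebesgue_measure I \is a fin_num)%E by rewrite ge0_fin_numE.
by rewrite lte_mul_pinfty ?mule_ge0 ?fin_numM.
Qed.

Lemma continuous_Lfun (g : space -> R) : continuous g -> g \in Lfun mu 2%:E.
Proof.
move=> cg; have mg := continuous_measurable_space cg.
have [M] := domain_sub_box.
pose I : set R := `[- M, M]%classic => OI.
have /compact_bounded[N [_ gN]] : compact (g @` ((I `*` I) `*` I)).
  apply: continuous_compact; first exact: continuous_subspaceT.
  by apply: compact_setX; [apply: compact_setX|]; exact: segment_compact.
have gb x : domain_set Omega x -> `|g x| <= N + 1.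
  by move=> /OI Ix; apply: (gN _ (ltr_pwDr ltr01 (lexx N))); exists x.
rewrite inE; apply/andP; split; rewrite inE//= /finite_norm unlock /Lnorm.
apply: poweR_lty.
apply: (@le_lt_trans _ _ (\int[mu]_x (cst ((N + 1) `^ 2)%:E x))%E).
  apply: ae_ge0_le_integral => //.
  - by move=> x _; exact: poweR_ge0.
  - apply/measurable_EFinP; apply: (measurableT_comp (measurable_powR _)).
    exact: measurableT_comp.
  - by move=> x _; rewrite lee_fin powR_ge0.
  - exists (~` Omega); split.
    + by apply: measurableC; exact: open_measurable_space (@domain_open _ Omega).
    + by rewrite /domain_measure /= /mrestr setICl measure0.
    + move=> x /= h Ox; apply: h => _; rewrite lee_fin.
      by apply: ge0_ler_powR; rewrite ?nnegrE ?normr_ge0// ?(le_trans _ (gb x Ox))//; exact: gb.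
rewrite integral_cst// lte_mul_pinfty ?lee_fin ?powR_ge0//.
exact: domain_measure_fin.
Qed.

Definition test_fun (phi : space -> R) :=
  smooth_on setT phi /\
  exists K, [/\ compact K, K `<=` Omega & forall x, ~ K x -> phi x = 0].

Lemma smooth_continuous (phi : space -> R) : smooth_on setT phi -> continuous phi.
Proof. by move=> /(_ 0)[+ _] x; apply; rewrite inE. Qed.

Lemma smooth_pderiv i (phi : space -> R) :
  smooth_on setT phi -> smooth_on setT (pderiv i phi).
Proof. by move=> sphi k; have [_ /(_ i)[]] := sphi k.+1. Qed.

Definition weak_deriv (i : 'I_3) (u p : L2 mu) :=
  forall phi, test_fun phi -> pairing u (pderiv i phi) = - pairing p phi.

Definition weak_grad : {pred L2 mu * {ffun 'I_3 -> L2 mu}} :=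
  fun up => `[< forall i, weak_deriv i up.1 (up.2 i) >].

Lemma weak_grad_submod_closed : submod_closed weak_grad.
Proof.
have pair0 g : g \in Lfun mu 2%:E -> pairing (0 : L2 mu) g = 0.
  move=> lg; have := pairing_linear 1 0 0 lg.
  by rewrite scaler0 addr0 mul1r => /eqP; rewrite -subr_eq0 opprD addNKr oppr_eq0 => /eqP.
have L phi : test_fun phi -> phi \in Lfun mu 2%:E.
  by case=> /smooth_continuous /continuous_Lfun.
have dL i phi : test_fun phi -> pderiv i phi \in Lfun mu 2%:E.
  by case=> /(smooth_pderiv i)/smooth_continuous /continuous_Lfun.
split.
  apply/asboolP => i phi tphi /=.
  by rewrite ffunE (pair0 _ (L _ tphi)) (pair0 _ (dL i _ tphi)) oppr0.
move=> a [u p] [v q] /asboolP /= up /asboolP /= vq; apply/asboolP => i phi tphi /=.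
rewrite !ffunE (pairing_linear _ _ _ (L _ tphi)).
rewrite (pairing_linear _ _ _ (dL i _ tphi)).
by rewrite up// vq// mulrN opprD.
Qed.

HB.instance Definition _ := GRing.isSubmodClosed.Build R
  (L2 mu * {ffun 'I_3 -> L2 mu})%type weak_grad weak_grad_submod_closed.

(* an element of H^1 carries its weak gradient, which is unique *)
Record H1 := MkH1 { H1val : L2 mu * {ffun 'I_3 -> L2 mu}; _ : H1val \in weak_grad }.
HB.instance Definition _ := [isSub for H1val].
HB.instance Definition _ := [Choice of H1 by <:].
HB.instance Definition _ := [SubChoice_isSubLmodule of H1 by <:].
End Sobolev.

Section HilbertSums.
Context (R : realType).

Lemma sqrt_addw_le (w X A B y c d : R) : 0 <= w -> 0 <= X -> 0 <= A -> 0 <= B ->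
  0 <= y -> 0 <= c -> 0 <= d ->
  Num.sqrt X <= Num.sqrt A + Num.sqrt B -> y <= c + d ->
  Num.sqrt (X + w * y ^+ 2) <=
    Num.sqrt (A + w * c ^+ 2) + Num.sqrt (B + w * d ^+ 2).
Proof.
move=> w0 X0 A0 B0 y0 c0 d0 XAB ycd.
set a := Num.sqrt A; set b := Num.sqrt B.
have a0 : 0 <= a by exact: sqrtr_ge0.
have b0 : 0 <= b by exact: sqrtr_ge0.
have aE : A = a ^+ 2 by rewrite sqr_sqrtr.
have bE : B = b ^+ 2 by rewrite sqr_sqrtr.
have Xab : X <= (a + b) ^+ 2.
  by rewrite -(sqr_sqrtr X0) lerXn2r// nnegrE ?sqrtr_ge0// addr_ge0.
have yy : y ^+ 2 <= (c + d) ^+ 2 by rewrite lerXn2r// nnegrE// addr_ge0.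
set P := Num.sqrt _ + Num.sqrt _.
have P0 : 0 <= P by rewrite addr_ge0 ?sqrtr_ge0.
rewrite -[leRHS](ger0_norm P0) -sqrtr_sqr ler_wsqrtr//.
have cc : 0 <= c ^+ 2 by exact: sqr_ge0.
have dd : 0 <= d ^+ 2 by exact: sqr_ge0.
have Ac : 0 <= A + w * c ^+ 2 by rewrite addr_ge0// mulr_ge0.
have Bd : 0 <= B + w * d ^+ 2 by rewrite addr_ge0// mulr_ge0.
have CS : a * b + w * (c * d) <= Num.sqrt (A + w * c ^+ 2) * Num.sqrt (B + w * d ^+ 2).
  have L0 : 0 <= a * b + w * (c * d) by rewrite addr_ge0 ?mulr_ge0.
  rewrite -sqrtrM// -[leLHS](ger0_norm L0) -sqrtr_sqr ler_wsqrtr// aE bE -subr_ge0.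
  have -> : (a ^+ 2 + w * c ^+ 2) * (b ^+ 2 + w * d ^+ 2) - (a * b + w * (c * d)) ^+ 2
          = w * (a * d - b * c) ^+ 2 by ring.
  by rewrite mulr_ge0// sqr_ge0.
rewrite /P sqrrD !sqr_sqrtr//.
have wyy : w * y ^+ 2 <= w * (c + d) ^+ 2 by rewrite ler_wpM2l.
move: Xab wyy CS; rewrite aE bE; set p := Num.sqrt _ * _.
by rewrite mulr2n !sqrrD !mulr2n !mulrDr; lra.
Qed.

Lemma sqrt_sum_le n (x a b : 'I_n -> R) :
  (forall i, 0 <= x i) -> (forall i, 0 <= a i) -> (forall i, 0 <= b i) ->
  (forall i, x i <= a i + b i) ->
  Num.sqrt (\sum_i x i ^+ 2) <= Num.sqrt (\sum_i a i ^+ 2) + Num.sqrt (\sum_i b i ^+ 2).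
Proof.
elim: n x a b => [|n IH] x a b x0 a0 b0 xab.
  by rewrite !big_ord0 sqrtr0 addr0.
rewrite !big_ord_recr /= -[x _ ^+ 2]mul1r -[a _ ^+ 2]mul1r -[b _ ^+ 2]mul1r.
apply: sqrt_addw_le => //; try by apply: sumr_ge0 => i _; exact: sqr_ge0.
by apply: IH.
Qed.

End HilbertSums.

Section H1_norm.
Context (R : realType) (Omega : smooth_domain R).
Local Notation mu := (domain_measure Omega).

Definition H1fun (u : H1 Omega) : L2 mu := (H1val u).1.
Definition H1grad (u : H1 Omega) (i : 'I_3) : L2 mu := (H1val u).2 i.

Definition H1norm (u : H1 Omega) : R :=
  Num.sqrt (`|H1fun u| ^+ 2 + \sum_(i < 3) `|H1grad u i| ^+ 2).

Let s0 (w : H1 Omega) : 0 <= \sum_(i < 3) `|H1grad w i| ^+ 2.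
Proof. by apply: sumr_ge0 => i _; exact: sqr_ge0. Qed.

Let H1normE u : H1norm u =
  Num.sqrt (\sum_(i < 3) `|H1grad u i| ^+ 2 + 1 * `|H1fun u| ^+ 2).
Proof. by rewrite mul1r addrC. Qed.

Lemma H1normD u v : H1norm (u + v) <= H1norm u + H1norm v.
Proof.
rewrite !H1normE; apply: sqrt_addw_le => //; last exact: ler_normD.
apply: sqrt_sum_le => // i; rewrite [H1grad (u + v) i]ffunE.
exact: ler_normD.
Qed.

Lemma H1normZ a u : H1norm (a *: u) = `|a| * H1norm u.
Proof.
rewrite -{1}[`|a|]ger0_norm// -sqrtr_sqr -sqrtrM ?sqr_ge0//; congr Num.sqrt.
rewrite mulrDr mulr_sumr; congr (_ + _); first by rewrite [H1fun _]/= normrZ exprMn.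
by apply: eq_bigr => i _; rewrite [H1grad _ i]ffunE normrZ exprMn.
Qed.

Lemma H1norm_eq0 u : H1norm u = 0 -> u = 0.
Proof.
move=> /eqP; rewrite sqrtr_eq0 => h.
have /eqP : `|H1fun u| ^+ 2 + \sum_(i < 3) `|H1grad u i| ^+ 2 = 0.
  by apply/le_anti; rewrite h addr_ge0// sqr_ge0.
rewrite paddr_eq0 ?sqr_ge0// sqrf_eq0 normr_eq0 => /andP[/eqP u0 /eqP p0].
have g0 : (H1val u).2 = 0.
  apply/ffunP => i; rewrite ffunE; apply/eqP.
  have /psumr_eq0P := p0 => /(_ (fun i _ => sqr_ge0 _) i isT)/eqP.
  by rewrite sqrf_eq0 normr_eq0.
by apply/val_inj; rewrite /= [LHS]surjective_pairing g0; congr pair.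
Qed.

HB.instance Definition _ :=
  Lmodule_isNormed.Build R (H1 Omega) H1normD H1normZ H1norm_eq0.
End H1_norm.

(* the norm, not the carrier, depends on eps *)
Definition energy (R : realType) (Omega : smooth_domain R) (eps : {posnum R}) : Type :=
  (H1 Omega * L2 (domain_measure Omega) * L2 (surface Omega) * L2 (surface Omega))%type.
HB.instance Definition _ R Omega eps := GRing.Lmodule.on (@energy R Omega eps).

Section Energy.
Context (R : realType) (Omega : smooth_domain R) (eps : {posnum R}).

Implicit Types z : energy Omega eps.
Definition zu z : H1 Omega := z.1.1.1.
Definition zv z : L2 (domain_measure Omega) := z.1.1.2.
Definition zdelta z : L2 (surface Omega) := z.1.2.
Definition zgamma z : L2 (surface Omega) := z.2.

Definition energy_norm z : R :=
  Num.sqrt (`|zu z| ^+ 2 + `|zv z| ^+ 2 + eps%:num * `|zdelta z| ^+ 2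
            + `|zgamma z| ^+ 2).

Let energy_normE z : energy_norm z =
  Num.sqrt (0 + 1 * `|zu z| ^+ 2 + 1 * `|zv z| ^+ 2 + eps%:num * `|zdelta z| ^+ 2
            + 1 * `|zgamma z| ^+ 2).
Proof. by rewrite !mul1r add0r. Qed.

Lemma energy_normD z z' : energy_norm (z + z') <= energy_norm z + energy_norm z'.
Proof.
rewrite !energy_normE.
do 4!(apply: sqrt_addw_le => //; last exact: ler_normD).
by rewrite sqrtr0 addr0.
Qed.

Lemma energy_normZ a z : energy_norm (a *: z) = `|a| * energy_norm z.
Proof.
rewrite -{1}[`|a|]ger0_norm// -sqrtr_sqr -sqrtrM ?sqr_ge0//; congr Num.sqrt.
rewrite /zu /zv /zdelta /zgamma /= !normrZ !exprMn.
by rewrite [eps%:num * _]mulrCA !mulrDr.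
Qed.

Lemma energy_norm_eq0 z : energy_norm z = 0 -> z = 0.
Proof.
move=> /eqP; rewrite sqrtr_eq0 => h.
have /eqP : `|zu z| ^+ 2 + `|zv z| ^+ 2 + eps%:num * `|zdelta z| ^+ 2
            + `|zgamma z| ^+ 2 = 0.
  by apply/le_anti; rewrite h !addr_ge0.
rewrite !paddr_eq0 ?addr_ge0// [eps%:num * _ == 0]mulf_eq0 (gt_eqF (gt0 eps)) !sqrf_eq0 !normr_eq0 orFb.
case: z {h} => [[[u v] de] ga]; rewrite /zu /zv /zdelta /zgamma /=.
by move=> /andP[/andP[/andP[/eqP-> /eqP->] /eqP->] /eqP->].
Qed.

HB.instance Definition _ :=
  Lmodule_isNormed.Build R (energy Omega eps) energy_normD energy_normZ energy_norm_eq0.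
End Energy.

Section FunctionClass.
Context d (T : measurableType d) (R : realType) (mu : {measure set T -> \bar R}).

(* class of a square-integrable function; junk value 0 otherwise *)
Definition L2of (h : T -> R) : L2 mu :=
  if pselect (h \in Lfun mu 2%:E) is left hL then L2class (Lfun_Sub (le1_2 R) hL)
  else 0.
End FunctionClass.

Section WeakOperators.
Context (R : realType) (Omega : smooth_domain R).
Local Notation mu := (domain_measure Omega).
Local Notation sigma := (surface Omega).

Definition is_laplacian (u w : L2 mu) :=
  forall phi, test_fun Omega phi ->
    pairing u (fun x => \sum_(i < 3) pderiv i (pderiv i phi) x) = pairing w phi.

(* the normal derivative of u in H^1 with square-integrable Laplacian, defined
   by Green's formula tested on functions smooth up to the boundary *)
Definition normal_deriv (u : H1 Omega) (gamma : L2 sigma) :=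
  exists2 w, is_laplacian (H1fun u) w &
    forall phi, smooth_on setT phi ->
      pairing w phi + \sum_(i < 3) pairing (H1grad u i) (pderiv i phi)
      = pairing gamma phi.

(* boundary trace: limit of the restrictions to the boundary of smooth functions
   converging in H^1 *)
Definition is_trace (v : H1 Omega) (tau : L2 sigma) :=
  exists phi : nat -> space R -> R,
    [/\ forall n, smooth_on setT (phi n),
        (\int[mu]_x ((phi n x - L2repr (H1fun v) x) ^+ 2)%:E @[n --> \oo] --> 0)%E,
        forall i, (\int[mu]_x ((pderiv i (phi n) x - L2repr (H1grad v i) x) ^+ 2)%:E
                     @[n --> \oo] --> 0)%E
      & (\int[sigma]_x ((phi n x - L2repr tau x) ^+ 2)%:E @[n --> \oo] --> 0)%E].

(* squared norms of H^1, H^2 and H^(1/2), equal to +oo outside of the space; weak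
   derivatives are unique, so that the infima range over at most one value *)
Definition H1_sqnorm (v : L2 mu) : \bar R :=
  ereal_inf [set (`|w| ^+ 2)%:E | w in [set w : H1 Omega | H1fun w = v]].

Definition H2_sqnorm (u : H1 Omega) : \bar R :=
  ereal_inf [set (`|u| ^+ 2 + \sum_(i < 3) \sum_(j < 3) `|q i j| ^+ 2)%:E |
    q in [set q : 'I_3 -> 'I_3 -> L2 mu |
           forall i j, weak_deriv j (H1grad u i) (q i j)]].

(* Sobolev-Slobodeckij norm on the two-dimensional boundary *)
Definition Hhalf_sqnorm (delta : L2 sigma) : \bar R :=
  ((`|delta| ^+ 2)%:E + \int[sigma]_x \int[sigma]_y
     ((L2repr delta x - L2repr delta y) ^+ 2 / euclid (x - y) ^+ 3)%:E)%E.
End WeakOperators.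

Section ProblemA.
Context (R : realType) (Omega : smooth_domain R) (eps : {posnum R}).
Local Notation H := (energy Omega eps).

(* graph of the operator A_eps, including the description of its domain *)
Definition acoustic_op (z z' : H) :=
  exists (lap : L2 (domain_measure Omega)) (v : H1 Omega) (tau : L2 (surface Omega)),
    [/\ is_laplacian (H1fun (zu z)) lap,
        H1fun v = zv z,
        normal_deriv (zu z) (zgamma z),
        is_trace v tau
      & z' = (v, lap - H1fun (zu z) - zv z, zgamma z,
              - tau - eps%:num *: zdelta z - eps%:num *: zgamma z) :> H].

Definition nonlinearity (f : R -> R) (z : H) : H :=
  (0, - L2of (domain_measure Omega) (f \o L2repr (H1fun (zu z))), 0, 0).

Definition D_eps : set H := [set z |
  [/\ (H2_sqnorm (zu z) < +oo)%E, (H1_sqnorm (zv z) < +oo)%E,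
      (Hhalf_sqnorm (zdelta z) < +oo)%E, (Hhalf_sqnorm (zgamma z) < +oo)%E
    & normal_deriv (zu z) (zgamma z)]].

Definition D_norm (z : H) : R :=
  Num.sqrt (fine (H2_sqnorm (zu z) + H1_sqnorm (zv z)
                  + eps%:num%:E * Hhalf_sqnorm (zdelta z)
                  + Hhalf_sqnorm (zgamma z))%E).

Definition D_bounded (B : set H) :=
  B `<=` D_eps /\ exists C : R, forall z, B z -> D_norm z <= C.
End ProblemA.

Section Dynamics.
Context (R : realType) (V : normedModType R).

Definition C0_contraction_semigroup (T : R -> V -> V) :=
  [/\ forall t, 0 <= t -> linear (T t),
      forall x, T 0 x = x,
      forall s t, 0 <= s -> 0 <= t -> forall x, T (s + t) x = T s (T t x),
      forall t x, 0 <= t -> `|T t x| <= `|x|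
    & forall x, T t x @[t --> 0^'+] --> x].

Definition generates (A : V -> V -> Prop) (T : R -> V -> V) :=
  C0_contraction_semigroup T /\
  forall x y, A x y <-> (h^-1 *: (T h x - x)) @[h --> 0^'+] --> y.

Definition is_riemann_integral (g : R -> V) (a b : R) (I : V) :=
  forall e, 0 < e -> exists2 eta, 0 < eta &
    forall (n : nat) (s xi : nat -> R), s 0%N = a -> s n = b ->
      (forall k, (k < n)%N ->
        [/\ s k <= xi k, xi k <= s k.+1 & s k.+1 - s k < eta]) ->
      `|\sum_(k < n) (s k.+1 - s k) *: g (xi k) - I| < e.

Definition mild_solution (T : R -> V -> V) (G : V -> V) (z0 : V) (z : R -> V) :=
  {within `[0, +oo[%classic, continuous z} /\
  forall t, 0 <= t -> exists2 I,
    is_riemann_integral (fun s => T (t - s) (G (z s))) 0 t I & z t = T t z0 + I.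

Definition solution_semiflow (T : R -> V -> V) (G : V -> V) (S : R -> V -> V) :=
  forall z0, mild_solution T G z0 (S^~ z0).

Definition semidist (A B : set V) : \bar R :=
  ereal_sup [set ereal_inf [set `|a - b|%:E | b in B] | a in A].

Definition global_attractor (S : R -> V -> V) (A : set V) :=
  [/\ compact A,
      forall t, 0 <= t -> S t @` A = A
    & forall B, B !=set0 -> bounded_set B ->
        semidist (S t @` B) A @[t --> +oo] --> 0%E].

Definition covering_number (M : set V) (r : R) : \bar R :=
  ereal_inf [set n%:R%:E | n in [set n | exists c : 'I_n -> V,
                                    M `<=` \bigcup_i ball (c i) r]].

Definition fractal_dim (M : set V) : \bar R :=
  limf_esup (fun r : R => lne (covering_number M r) * ((- ln r)^-1)%:E)%E 0^'+.

Definition exponential_rate (S : R -> V -> V) (M : set V) :=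
  exists (Q : R -> R) (nu : R),
    [/\ 0 < nu, forall x, 0 <= x -> 0 <= Q x,
        forall x y, 0 <= x -> x <= y -> Q x <= Q y
      & forall B, B !=set0 -> bounded_set B -> forall t, 0 <= t ->
          (semidist (S t @` B) M
             <= (Q (sup [set `|z| | z in B]) * expR (- (nu * t)))%:E)%E].
End Dynamics.

Definition exponential_attractor (R : realType) (Omega : smooth_domain R)
    (eps : {posnum R}) (S : R -> energy Omega eps -> energy Omega eps)
    (M : set (energy Omega eps)) :=
  [/\ compact M, D_bounded M, forall t, 0 <= t -> S t @` M `<=` M,
      (fractal_dim M < +oo)%E & exponential_rate S M].

Definition C2 (R : realType) (f : R -> R) :=
  [/\ forall s, derivable f s 1, forall s, derivable (derive1 f) s 1
    & continuous (derive1n 2 f)].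

Definition abs_infty (R : realType) : set_system R :=
  [set P | exists N, forall s, N < `|s| -> P s].

(* Main.v *)
Require Import Defs.
From HB Require Import structures.
From mathcomp Require Import all_boot all_order all_algebra.
From mathcomp Require Import all_classical all_reals all_analysis.
Set Implicit Arguments.
Unset Strict Implicit.
Unset Printing Implicit Defensive.
Import Order.TTheory GRing.Theory Num.Theory.
Import numFieldNormedType.Exports.
Local Open Scope classical_set_scope.
Local Open Scope ring_scope.

(** The global attractor [A] is compact, hence bounded, so the exponential
attractor [M] attracts it: the semidistance from [S t @` A] to [M] tends to 0.
But [A] is invariant, so this semidistance does not depend on [t], and it is
therefore 0, which puts [A] in the closure of the compact set [M], that is, in
[M] itself ([invariant_sub_attracting]).  Everything else is monotonicity under
inclusion: a bound in the regularity space passes from [M] to [A], and so does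
the fractal dimension, since every cover of [M] covers [A]
([fractal_dim_le]). *)

Lemma limf_esup_le (R : realType) (T : choiceType) (X : filteredType T)
    (F : set_system X) (f g : X -> \bar R) : Filter F ->
  (\forall x \near F, (f x <= g x)%E) -> (limf_esup f F <= limf_esup g F)%E.
Proof.
move=> FF fg; apply: le_ereal_inf_tmp => _ /= [V FV <-].
have FVW : F (V `&` [set x | (f x <= g x)%E]) by exact: filterI.
apply: ge_ereal_inf; exists (ereal_sup (f @` (V `&` [set x | (f x <= g x)%E]))).
  by exists (V `&` [set x | (f x <= g x)%E]).
apply: ge_ereal_sup => _ /= [x [Vx fgx] <-].
by apply: (le_trans fgx); apply: ereal_sup_ubound; exists x.
Qed.

Section NormedSpace.
Context (R : realType) (V : normedModType R).
Implicit Types A B M : set V.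

Lemma covering_number_ge0 M r : (0 <= covering_number M r)%E.
Proof. by apply: le_ereal_inf_tmp => _ [n _ <-]; rewrite lee_fin. Qed.

Lemma covering_number_le A M r :
  A `<=` M -> (covering_number A r <= covering_number M r)%E.
Proof.
move=> AM; apply: ereal_inf_le_tmp => _ [n [c Mc] <-].
by exists n => //; exists c; exact: subset_trans Mc.
Qed.

(** Only radii below 1 count in the upper limit; for these the denominator
[- ln r] is positive, so the quotient inherits the monotonicity of the covering
number. *)
Lemma fractal_dim_le A M : A `<=` M -> (fractal_dim A <= fractal_dim M)%E.
Proof.
move=> AM; apply: limf_esup_le; near=> r.
have r0 : 0 < r by near: r; exact: nbhs_right_gt.
have r1 : r < 1 by near: r; exact: nbhs_right_lt.
apply: lee_wpmul2r; first by rewrite lee_fin invr_ge0 oppr_ge0 ln_le0// ltW.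
rewrite lee_lne ?covering_number_le// in_itv /= leey andbT;
  exact: covering_number_ge0.
Unshelve. all: by end_near. Qed.

Lemma semidist_le0_closure A M : (semidist A M <= 0)%E -> A `<=` closure M.
Proof.
move=> d0 a Aa U /nbhs_ballP[e /= e0 eU].
have : (ereal_inf [set `|a - b|%:E | b in M] < e%:E)%E.
  apply: (@le_lt_trans _ _ 0%E); last by rewrite lte_fin.
  by apply: le_trans d0; apply: ereal_sup_ubound; exists a.
move=> /ereal_inf_lt[_ [b Mb <-]]; rewrite lte_fin => abe.
by exists b; split => //; apply: eU; rewrite -ball_normE.
Qed.

(** Invariance turns the decaying bound on the semidistance from [S t @` A] to
[M] into a bound, for every [t], on the fixed semidistance from [A] to [M]. *)
Lemma invariant_sub_attracting (S : R -> V -> V) A M :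
  bounded_set A -> (forall t, 0 <= t -> S t @` A = A) ->
  closed M -> exponential_rate S M -> A `<=` M.
Proof.
move=> bA SA cM [Q [nu [nu0 _ _ SM]]] a Aa.
apply: cM; move: a Aa; have [->//|/set0P A0] := eqVneq A set0.
apply: semidist_le0_closure; apply/lee_addgt0Pr => e e0; rewrite add0e.
set K := Q (sup [set `|z| | z in A]).
(* at this time [expR (nu * t) >= 1 + nu * t] already makes the decaying
   bound smaller than [e] *)
pose t := `|K| / e / nu.
have t0 : 0 <= t by rewrite /t !divr_ge0// ltW.
have := SM A A0 bA t t0; rewrite SA// => /le_trans; apply.
rewrite lee_fin expRN ler_pdivrMr ?expR_gt0//.
apply: (@le_trans _ _ (e * (1 + nu * t))); last first.
  by rewrite ler_pM2l// expR_ge1Dx.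
rewrite /t mulrDr mulr1 [nu * _]mulrC divfK ?gt_eqF// mulrC divfK ?gt_eqF//.
by rewrite (le_trans (ler_norm K))// lerDr ltW.
Qed.

End NormedSpace.

Lemma ltey_le_pos (R : realType) (x : \bar R) :
  (x < +oo)%E -> exists2 C : R, 0 < C & (x <= C%:E)%E.
Proof.
case: x => [x _|//|_]; last by exists 1; rewrite ?leNye.
exists (`|x| + 1); first by rewrite ltr_wpDl.
by rewrite lee_fin (le_trans (ler_norm x))// lerDl.
Qed.

Theorem corollary3p23 (R : realType) (Omega : smooth_domain R) (f : R -> R)
    (l1 l2 : R)
    (f_C2 : C2 f)
    (f_liminf : (-1 < limf_einf (fun s : R => (f s / s)%:E) (@abs_infty R))%E)
    (l1_ge0 : 0 <= l1) (l2_ge0 : 0 <= l2)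
    (f_growth : forall s, `|derive1n 2 f s| <= l1 * (1 + `|s|))
    (f_deriv : forall s, - l2 <= derive1 f s)
    (eps : {posnum R}) (eps_le1 : eps%:num <= 1)
    (T S : R -> energy Omega eps -> energy Omega eps)
    (T_gen : generates (@acoustic_op R Omega eps) T)
    (S_sol : solution_semiflow T (nonlinearity f) S)
    (A M : set (energy Omega eps))
    (A_attr : global_attractor S A)
    (M_attr : exponential_attractor S M) :
  [/\ D_bounded A,
      (fractal_dim A <= fractal_dim M)%E,
      exists2 C : R, 0 < C & (fractal_dim M <= C%:E)%E
    & (fractal_dim A < +oo)%E].
Proof.
case: A_attr => cA SA _; case: M_attr => cM [MD [C MC]] _ Mfin SM.
have AM : A `<=` M.
  apply: invariant_sub_attracting SA _ SM; first exact: compact_bounded.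
  by apply: compact_closed cM; exact: norm_hausdorff.
have dAM := fractal_dim_le AM.
split=> //; last exact: le_lt_trans Mfin.
- split; first exact: subset_trans MD.
  by exists C => z /AM/MC.
- exact: ltey_le_pos.
Qed.
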